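(* Let $A\in\mathbb{R}^{n\times n}$, $B\in\mathbb{R}^{n\times m}$, let $W\in\mathbb{R}^{n\times n}$ be symmetric positive definite and $U\in\mathbb{R}^{m\times m}$ symmetric positive semidefinite, and let $\bar\nu_1,\dots,\bar\nu_m\in[0,1]$. With $\eta_I$, $N_I$ and $\phi$ as defined in the context, the following statements are equivalent: (1) There exist a matrix $\bar K\in\mathbb{R}^{n\times m}$ and a symmetric matrix $\bar S\in\mathbb{R}^{n\times n}$ such that $\bar S>0$ and $\bar S>\phi(\bar K,\bar S)$. (2) There exist a matrix $Z\in\mathbb{R}^{n\times m}$ and a symmetric matrix $Y\in\mathbb{R}^{n\times n}$ with $Y>0$ such that the following symmetric block matrix is positive definite: \[ \begin{bmatrix} Y & Y & \eta_{\emptyset}(YA^T+ZN_{\emptyset}B^T) & \eta_{\emptyset}ZN_{\emptyset}U^{1/2} & \cdots & \eta_{\Im}(YA^T+ZN_{\Im}B^T) & \eta_{\Im}ZN_{\Im}U^{1/2}\\ Y & W^{-1} & 0 & 0 & \cdots & 0 & 0\\ \ast & 0 & Y & 0 & \cdots & 0 & 0\\ \ast & 0 & 0 & I & \cdots & 0 & 0\\ \vdots & \vdots & \vdots & \vdots & \ddots & \vdots & \vdots\\ \ast & 0 & 0 & 0 & \cdots & Y & 0\\ \ast & 0 & 0 & 0 & \cdots & 0 & I \end{bmatrix}>0 . \] Here, after the first two block rows and columns (of size $n$ each), there is one pair of block rows/columns of sizes $n$ and $m$ for each subset $I\in 2^{\Im}$, listed from $\emptyset$ to $\Im$. The entries of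 the first block row in the pair belonging to $I$ are $\eta_I(YA^T+ZN_IB^T)$ and $\eta_I ZN_IU^{1/2}$, the diagonal blocks in that pair are $Y$ and the $m\times m$ identity $I$, the symbols $\ast$ denote the transposes of the corresponding first-row entries, and all remaining blocks are zero.
   Context: $\Im=\{1,\dots,m\}$ and $2^{\Im}$ is the set of all subsets of $\Im$. For $I\in 2^{\Im}$, $N_I\in\mathbb{R}^{m\times m}$ is the diagonal matrix whose $i$-th diagonal entry is $1$ if $i\in I$ and $0$ otherwise, and \[ \eta_I=\sqrt{\Big(\prod_{i\in I}\bar\nu_i\Big)\Big(\prod_{i\in\Im\setminus I}(1-\bar\nu_i)\Big)} . \] For $K\in\mathbb{R}^{n\times m}$ and symmetric $X\in\mathbb{R}^{n\times n}$, \[ \phi(K,X)=\sum_{I\in 2^{\Im}}\eta_I^2\left(F_IXF_I^T+V_I\right),\qquad F_I=A^T+KN_IB^T,\qquad V_I=W+KN_IUN_I^TK^T . \] $U^{1/2}$ is the symmetric positive semidefinite square root of $U$. For symmetric matrices, $X>Y$ (resp. $X\ge Y$) means that $X-Y$ is positive definite (resp. positive semidefinite). *)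

(* Defs.v *)
From mathcomp Require Import all_boot all_order all_algebra.
From mathcomp Require Import boolp classical_sets reals.
From mathcomp Require Import finset.
Set Implicit Arguments.
Unset Strict Implicit.
Unset Printing Implicit Defensive.
Import Order.TTheory GRing.Theory Num.Theory.
Local Open Scope ring_scope.

Definition posdefmx (R : realType) (p : nat) (X : 'M[R]_p) : Prop :=
  X^T = X /\ forall x : 'cV[R]_p, x != 0 -> 0 < (x^T *m X *m x) 0 0.

Definition possemidefmx (R : realType) (p : nat) (X : 'M[R]_p) : Prop :=
  X^T = X /\ forall x : 'cV[R]_p, 0 <= (x^T *m X *m x) 0 0.

(* U^{1/2}: every positive semidefinite U has exactly one positive semidefinite
   square root, so the default value 0 only occurs when U is not positive
   semidefinite. *)
Definition psd_sqrtmx (R : realType) (p : nat) (U : 'M[R]_p) : 'M[R]_p :=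
  xget 0 [set S : 'M[R]_p | possemidefmx S /\ S *m S = U]%classic.

Definition Nmx (R : realType) (m : nat) (I : {set 'I_m}) : 'M[R]_m :=
  diag_mx (\row_i (i \in I)%:R).

Definition eta (R : realType) (m : nat) (nu : 'I_m -> R) (I : {set 'I_m}) : R :=
  Num.sqrt ((\prod_(i in I) nu i) * (\prod_(i in ~: I) (1 - nu i))).

Definition Fmx (R : realType) (n m : nat) (A : 'M[R]_n) (B : 'M[R]_(n, m))
    (K : 'M[R]_(n, m)) (I : {set 'I_m}) : 'M[R]_n :=
  A^T + K *m Nmx R I *m B^T.

Definition Vmx (R : realType) (n m : nat) (W : 'M[R]_n) (U : 'M[R]_m)
    (K : 'M[R]_(n, m)) (I : {set 'I_m}) : 'M[R]_n :=
  W + K *m Nmx R I *m U *m (Nmx R I)^T *m K^T.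

Definition phi (R : realType) (n m : nat) (A : 'M[R]_n) (B : 'M[R]_(n, m))
    (W : 'M[R]_n) (U : 'M[R]_m) (nu : 'I_m -> R)
    (K : 'M[R]_(n, m)) (X : 'M[R]_n) : 'M[R]_n :=
  \sum_(I : {set 'I_m})
    eta nu I ^+ 2 *:
      (Fmx A B K I *m X *m (Fmx A B K I)^T + Vmx W U K I).

(* The k-th subset of 'I_m, k < 2 ^ m, read off the binary digits of k; this
   lists all the subsets once each, from the empty set to the full set (see the
   lemmas below). *)
Definition subset_of (m : nat) (k : 'I_(2 ^ m)) : {set 'I_m} :=
  [set i : 'I_m | odd (k %/ 2 ^ i)]%SET.

Lemma subset_of_inj (m : nat) : injective (@subset_of m).
Proof.
have bits_inj : forall p a b, (a < 2 ^ p -> b < 2 ^ p ->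
    (forall i, i < p -> odd (a %/ 2 ^ i) = odd (b %/ 2 ^ i)) -> a = b)%N.
  elim=> [|p IHp] a b; first by rewrite expn0 !ltnS !leqn0 => /eqP-> /eqP->.
  move=> lt_a lt_b eq_ab.
  have eq0 : odd a = odd b by have := eq_ab 0%N isT; rewrite expn0 !divn1.
  have eq_half : (a %/ 2 = b %/ 2)%N.
    apply: IHp; rewrite ?ltn_divLR -?expnSr // => i lt_ip.
    by rewrite -!divnMA -!expnS; apply: eq_ab.
  by rewrite -[a]odd_double_half -[b]odd_double_half -!divn2 eq_half eq0.
move=> a b /setP eq_ab; apply: val_inj; apply: (bits_inj m) (ltn_ord a) (ltn_ord b) _ => i lt_im.
by have := eq_ab (Ordinal lt_im); rewrite !inE.
Qed.

Lemma subset_of_bij (m : nat) : bijective (@subset_of m).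
Proof.
apply: inj_card_bij (@subset_of_inj m) _.
by rewrite card_ord -cardsT -powersetT card_powerset cardsT card_ord.
Qed.

Lemma subset_of_first (m : nat) (k : 'I_(2 ^ m)) :
  k = 0%N :> nat -> subset_of k = set0.
Proof. by move=> k0; apply/setP => i; rewrite !inE k0 div0n. Qed.

Lemma subset_of_last (m : nat) (k : 'I_(2 ^ m)) :
  k = (2 ^ m).-1 :> nat -> subset_of k = [set: 'I_m]%SET.
Proof.
move=> kE; apply/setP => i; rewrite !inE kE.
have lt_im : (i <= m)%N := ltnW (ltn_ord i).
have -> : ((2 ^ m).-1 = (2 ^ (m - i)).-1 * 2 ^ i + (2 ^ i).-1)%N.
  have p1 : (0 < 2 ^ (m - i))%N by rewrite expn_gt0.
  have p2 : (0 < 2 ^ i)%N by rewrite expn_gt0.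
  rewrite -[in LHS](subnK lt_im) expnD.
  case: (2 ^ (m - i))%N p1 => // a _; case: (2 ^ i)%N p2 => // b _.
  by rewrite mulSn addSn !succnK addnC.
have p2 : (0 < 2 ^ i)%N by rewrite expn_gt0.
rewrite divnMDl // divn_small ?addn0 ?prednK //.
have : (0 < m - i)%N by rewrite subn_gt0.
case: (m - i)%N => // d _.
have p3 : (0 < 2 ^ d.+1)%N by rewrite expn_gt0.
have := oddX 2 d.+1; rewrite -{1}(prednK p3) oddS /=.
by case: (odd _).
Qed.

(* The four groups of blocks split the matrix after its first two block rows
   and columns (of size n each); the 2 ^ m remaining pairs have size n + m. *)
Definition lmi_mx (R : realType) (n m : nat) (A : 'M[R]_n) (B : 'M[R]_(n, m))
    (W : 'M[R]_n) (U : 'M[R]_m) (nu : 'I_m -> R)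
    (Z : 'M[R]_(n, m)) (Y : 'M[R]_n) :
    'M[R]_((n + n) + (\sum_(k < 2 ^ m) (n + m))%N) :=
  let top_row : 'M[R]_(n, (\sum_(k < 2 ^ m) (n + m))%N) :=
    \mxrow_(k < 2 ^ m)
      (let I := subset_of k in
       row_mx (eta nu I *: (Y *m A^T + Z *m Nmx R I *m B^T))
              (eta nu I *: (Z *m Nmx R I *m psd_sqrtmx U))) in
  let top_right := col_mx top_row 0 in
  block_mx (block_mx Y Y Y (invmx W)) top_right
           top_right^T                (\mxdiag_(k < 2 ^ m) block_mx Y 0 0 1%:M).

(* Main.v *)
Require Import Defs.
From mathcomp Require Import all_boot all_order all_algebra.
From mathcomp Require Import reals classical_sets spectral complex.
Set Implicit Arguments.
Unset Strict Implicit.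
Unset Printing Implicit Defensive.
Import Order.TTheory GRing.Theory Num.Theory.
Local Open Scope ring_scope.

(** Put [Y = S^-1] and [Z = Y K]. The diagonal blocks of (2) after the first
    are positive definite, so (2) amounts to the positivity of the Schur
    complement
    [Y - sum_I eta_I^2 (Y F_I Y^-1 F_I^T Y + Z N_I U N_I Z^T) - Y W Y].
    Since the [eta_I^2] add up to 1, being the terms of the expansion of
    [prod_i (nu_i + (1 - nu_i))], this complement is [Y (S - phi K S) Y]. *)

(** * Positive definite matrices, congruence and Schur complements *)

Lemma trmxZ (R : pzRingType) (n p : nat) (a : R) (X : 'M[R]_(n, p)) :
  (a *: X)^T = a *: X^T.
Proof. exact: linearZ. Qed.

Lemma mulmx_tr_self_ge0 (R : realDomainType) (n : nat) (x : 'cV[R]_n) :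
  0 <= (x^T *m x) 0 0.
Proof. by rewrite mxE sumr_ge0 // => i _; rewrite mxE -expr2 sqr_ge0. Qed.

Lemma mulmx_tr_self_gt0 (R : realDomainType) (n : nat) (x : 'cV[R]_n) :
  x != 0 -> 0 < (x^T *m x) 0 0.
Proof.
move=> x0; rewrite lt_neqAle mulmx_tr_self_ge0 andbT eq_sym.
apply: contra x0; rewrite mxE psumr_eq0 => [/allP x0|i _].
  apply/eqP/colP => i; have := x0 i (mem_index_enum i).
  by rewrite !mxE mulf_eq0 orbb => /eqP.
by rewrite mxE -expr2 sqr_ge0.
Qed.

Lemma posdefmx1 (R : realType) (n : nat) : posdefmx (1%:M : 'M[R]_n).
Proof.
by split=> [|x x0]; rewrite ?trmx1 // mulmx1; apply: mulmx_tr_self_gt0.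
Qed.

(** A nonzero row [v] of the kernel would give [v X v^T = 0]. *)
Lemma posdefmx_unit (R : realType) (n : nat) (X : 'M[R]_n) :
  posdefmx X -> X \in unitmx.
Proof.
case=> _ pX; rewrite -row_free_unit -kermx_eq0.
apply/eqP/row_matrixP => i; rewrite row0; apply/eqP/negPn/negP => k0.
have: (row i (kermx X))^T != 0 by rewrite trmx_eq0.
by move/pX; rewrite trmxK -row_mul mulmx_ker row0 mul0mx mxE ltxx.
Qed.

Lemma posdefmx_congr (R : realType) (n : nat) (X C : 'M[R]_n) :
  C \in unitmx -> posdefmx (C^T *m X *m C) <-> posdefmx X.
Proof.
have congr (Y P : 'M[R]_n) : P \in unitmx -> posdefmx Y ->
    posdefmx (P^T *m Y *m P).
  move=> uP [sY pY]; split=> [|x x0].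
    by rewrite !trmx_mul trmxK sY mulmxA.
  have := pY (P *m x); rewrite trmx_mul !mulmxA; apply.
  by apply: contra x0 => /eqP Px0; rewrite -[x](mulKmx uP) Px0 mulmx0.
move=> uC; split=> [pX|]; last exact: congr.
have := congr _ (invmx C) _ pX; rewrite unitmx_inv => /(_ uC).
by rewrite trmx_inv !mulmxA mulVmx ?unitmx_tr // mul1mx mulmxK.
Qed.

Lemma posdefmx_inv (R : realType) (n : nat) (X : 'M[R]_n) :
  posdefmx X -> posdefmx (invmx X).
Proof.
move=> pX; have uX := posdefmx_unit pX.
apply/(posdefmx_congr _ uX); rewrite pX.1 mulmxV // mul1mx.
exact: pX.
Qed.

Lemma posdefmx_block_diag (R : realType) (n p : nat) (X : 'M[R]_n)
    (D : 'M[R]_p) :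
  posdefmx (block_mx X 0 0 D) <-> posdefmx X /\ posdefmx D.
Proof.
have quad (x : 'cV_n) (y : 'cV_p) :
    ((col_mx x y)^T *m block_mx X 0 0 D *m col_mx x y) 0 0 =
    (x^T *m X *m x) 0 0 + (y^T *m D *m y) 0 0.
  by rewrite tr_col_mx mul_row_block !mulmx0 addr0 add0r mul_row_col mxE.
split=> [[]|[[sX pX] [sD pD]]].
  rewrite tr_block_mx !trmx0 => /eq_block_mx[sX _ _ sD] pXD.
  split; split=> // x x0.
    have := pXD (col_mx x 0); rewrite quad mulmx0 [X in _ + X]mxE addr0; apply.
    by rewrite col_mx_eq0 (negPf x0).
  have := pXD (col_mx 0 x); rewrite quad mulmx0 [X in X + _]mxE add0r; apply.
  by rewrite col_mx_eq0 (negPf x0) andbF.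
split=> [|z]; first by rewrite tr_block_mx !trmx0 sX sD.
rewrite -[z]vsubmxK quad col_mx_eq0.
have [-> /=|x0 _] := eqVneq (usubmx z) 0.
  by rewrite mulmx0 [X in X + _]mxE add0r; apply: pD.
have [->|y0] := eqVneq (dsubmx z) 0.
  by rewrite mulmx0 [X in _ + X]mxE addr0; apply: pX.
by rewrite addr_gt0 ?pX ?pD.
Qed.

Lemma posdefmx_mxdiag (R : realType) (p : nat) (p_ : 'I_p -> nat)
    (D : forall i, 'M[R]_(p_ i)) :
  (forall i, posdefmx (D i)) -> posdefmx (\mxdiag_i D i).
Proof.
move=> pD; split=> [|x].
  by rewrite tr_mxdiag; apply: eq_mxdiag => i; case: (pD i).
rewrite -[x]submxcolK tr_mxcol mul_mxrow_mxdiag mul_mxrow_mxcol summxE => x0.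
have D_ge0 i : 0 <= ((submxcol x i)^T *m D i *m submxcol x i) 0 0.
  have [->|xi0] := eqVneq (submxcol x i) 0; first by rewrite mulmx0 mxE.
  by rewrite ltW // (pD i).2.
rewrite lt_neqAle sumr_ge0 // andbT eq_sym.
apply: contra x0; rewrite psumr_eq0 // => /allP sum0.
rewrite -mxcol0; apply/eqP/eq_mxcol => i; apply/eqP/negPn/negP => xi0.
have := (pD i).2 _ xi0; have := sum0 i (mem_index_enum i).
by move=> /= /eqP ->; rewrite ltxx.
Qed.

(** Block elimination: the unit lower triangular [L] with off-diagonal block [D^-1 Q^T] is a
    congruence between the matrix and the block diagonal of the Schur complement and [D]. *)
Lemma posdefmx_schur (R : realType) (n p : nat) (P : 'M[R]_n)
    (Q : 'M[R]_(n, p)) (D : 'M[R]_p) :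
  posdefmx D ->
  posdefmx (block_mx P Q Q^T D) <-> posdefmx (P - Q *m invmx D *m Q^T).
Proof.
move=> pD; have uD := posdefmx_unit pD.
pose L : 'M[R]_(n + p) := block_mx 1%:M 0 (invmx D *m Q^T) 1%:M.
have uL : L \in unitmx by rewrite unitmxE det_lblock !det1 mulr1 unitr1.
have -> : block_mx P Q Q^T D =
    L^T *m block_mx (P - Q *m invmx D *m Q^T) 0 0 D *m L.
  rewrite tr_block_mx !trmx0 !trmx1 trmx_mul trmxK trmx_inv pD.1.
  rewrite !mulmx_block !mulmx0 !mul0mx !mulmx1 !mul1mx !addr0 !add0r.
  by rewrite mulmxKV // mulKVmx // mulmxA subrK.
split=> [/(posdefmx_congr _ uL)/posdefmx_block_diag[] // | pS].
by apply/(posdefmx_congr _ uL)/posdefmx_block_diag.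
Qed.

(** * Existence of the positive semidefinite square root *)

Lemma poly_interpolation (F : fieldType) (f : F -> F) (s : seq F) :
  exists p : {poly F}, {in s, forall x, p.[x] = f x}.
Proof.
elim: s => [|a s [p pP]]; first by exists 0.
have [a_s|a_s] := boolP (a \in s).
  by exists p => x /[!inE] /predU1P[->|]; apply: pP.
pose q : {poly F} := \prod_(b <- s) ('X - b%:P).
(* Newton's correction: the added term vanishes on [s] and repairs the value at [a]. *)
exists (p + ((f a - p.[a]) / q.[a]) *: q) => x /[!inE] /predU1P[->|x_s].
  have qa0 : q.[a] != 0 by rewrite -rootE root_prod_XsubC.
  by rewrite hornerD hornerZ divfK // addrC subrK.
have /eqP qx0 : q.[x] == 0 by rewrite -rootE root_prod_XsubC.
by rewrite hornerD hornerZ qx0 mulr0 addr0 pP.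
Qed.

(** Over [C] the matrix becomes Hermitian, so the spectral theorem applies and its eigenvalues are
    real, hence come from [R]. Only the eigenvalues descend to [R]; [P] stays over [C]. *)
Lemma real_symmetric_diagonalization (R : fieldType) (C : numClosedFieldType)
    (f : {rmorphism R -> C}) (n : nat) (X : 'M[R]_n) :
  (forall z, z \is Num.real <-> exists x, z = f x) -> X^T = X ->
  exists (P : 'M[C]_n) (d : 'rV[R]_n), P \in unitmx /\
    map_mx f X = invmx P *m diag_mx (map_mx f d) *m P.
Proof.
move=> fP sX; pose XC := map_mx f X.
have realX : XC \is a mxOver Num.real.
  by apply/mxOverP => i j; rewrite mxE; apply/fP; exists (X i j).
have symX : XC \is symmetricmx.
  by apply/is_hermitianmxP; rewrite expr0 scale1r map_mx_id // /XC map_trmx sX.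
have hermX := realsym_hermsym symX realX.
have /fin_all_exists[d dP] i : exists x, spectral_diag XC 0 i = f x.
  by apply/fP; have /mxOverP := hermitian_spectral_diag_real hermX; apply.
exists (spectralmx XC), (\row_i d i); split; first exact: spectral_unit.
have /orthomx_spectralP defX := hermitian_normalmx hermX.
rewrite [LHS]defX; congr (_ *m diag_mx _ *m _).
by apply/rowP => i; rewrite 2!mxE dP.
Qed.

Lemma possemidefmx_eigenvalue_ge0 (R : realType) (n : nat) (X : 'M[R]_n)
    (a : R) :
  possemidefmx X -> eigenvalue X a -> 0 <= a.
Proof.
move=> [_ pX] /eigenvalueP[v vX v0].
have := pX v^T; rewrite trmxK vX -scalemxAl mxE pmulr_lge0 //.
by rewrite -[v in v *m _]trmxK mulmx_tr_self_gt0 // trmx_eq0.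
Qed.

(** Transposition reverses products, which is harmless because a matrix commutes with its own
    polynomials. *)
Lemma tr_horner_mx (R : comNzRingType) (n : nat) (X : 'M[R]_n.+1)
    (q : {poly R}) :
  (horner_mx X q)^T = horner_mx X^T q.
Proof.
elim/poly_ind: q => [|q c IHq]; first by rewrite !rmorph0 trmx0.
rewrite !rmorphD !rmorphM /= !horner_mx_X !horner_mx_C linearD /= tr_scalar_mx.
rewrite trmx_mul IHq; congr (_ + _).
exact/comm_mx_sym/comm_horner_mx.
Qed.

(* With q a polynomial taking the value a^(1/4) at each eigenvalue a of X, the
   square root is q(X)^2, which is a Gram matrix because q(X) is symmetric. *)
Lemma possemidefmx_sqrt_exists (R : realType) (n : nat) (X : 'M[R]_n) :
  possemidefmx X -> exists S : 'M[R]_n, possemidefmx S /\ S *m S = X.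
Proof.
(* [horner_mx] needs a size of the form [n.+1]; in size 0 all matrices are equal. *)
case: n X => [|n] X pX.
  by exists X; split=> //; apply/matrixP; case.
have [C [f fP]] : exists (C : numClosedFieldType) (f : {rmorphism R -> C}),
    forall z, z \is Num.real <-> exists x, z = f x.
  by exists R[i], (real_complex R) => z; split=> /complex_realP.
have [P [d [uP defX]]] := real_symmetric_diagonalization fP pX.1.
have d_ge0 i : 0 <= d 0 i.
  apply: possemidefmx_eigenvalue_ge0 pX _.
  rewrite -(eigenvalue_map f) defX; apply/eigenvalueP.
  (* The rows of [P] are left eigenvectors of [P^-1 diag(d) P]. *)
  exists (row i P); last first.
    rewrite rowE mulmx_free_eq0 ?row_free_unit //.
    apply/eqP => /rowP/(_ i)/eqP.
    by rewrite !mxE !eqxx oner_eq0.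
  rewrite -row_mul !mulmxA mulmxV // mul1mx row_mul row_diag_mx mxE.
  by rewrite -scalemxAl -rowE.
have [q qP] := poly_interpolation (fun x => Num.sqrt (Num.sqrt x))
  [seq d 0 i | i <- enum 'I_n.+1].
pose T := horner_mx X q.
have symT : T^T = T.
  by rewrite /T tr_horner_mx pX.1.
have T4 : T *m T *m (T *m T) = X.
  have -> : T *m T *m (T *m T) = horner_mx X (q * q * (q * q)).
    by rewrite !rmorphM.
  (* The identity is checked over [C], where a polynomial in [X] acts on the diagonal entries
     [d 0 i] one by one. *)
  apply: (@map_mx_inj _ _ f).
  rewrite map_horner_mx defX horner_mx_uconjC // horner_mx_diag.
  congr (_ *m diag_mx _ *m _); apply/rowP => i.
  rewrite !mxE horner_map !hornerM qP ?map_f ?mem_enum // -!expr2.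
  by rewrite !sqr_sqrtr ?sqrtr_ge0.
exists (T *m T); split=> //; split=> [|x]; first by rewrite trmx_mul symT.
by rewrite -{1}symT mulmxA -trmx_mul -mulmxA mulmx_tr_self_ge0.
Qed.

(** Since a root exists, [xget] does not fall back on its default value. *)
Lemma psd_sqrtmxP (R : realType) (n : nat) (X : 'M[R]_n) :
  possemidefmx X ->
  possemidefmx (psd_sqrtmx X) /\ psd_sqrtmx X *m psd_sqrtmx X = X.
Proof.
move=> /possemidefmx_sqrt_exists[S SP].
by rewrite /psd_sqrtmx; case: xgetP => [_ -> //|/(_ S)].
Qed.

(** * The weights [eta_I^2] *)

Lemma eta_sqr (R : realType) (m : nat) (nu : 'I_m -> R) (I : {set 'I_m}) :
  (forall i, 0 <= nu i <= 1) ->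
  eta nu I ^+ 2 = (\prod_(i in I) nu i) * (\prod_(i in ~: I) (1 - nu i)).
Proof.
move=> nu01; rewrite sqr_sqrtr // mulr_ge0 // prodr_ge0 // => i _.
  by case/andP: (nu01 i).
by rewrite subr_ge0; case/andP: (nu01 i).
Qed.

Lemma sum_eta_sqr (R : realType) (m : nat) (nu : 'I_m -> R) :
  (forall i, 0 <= nu i <= 1) -> \sum_(I : {set 'I_m}) eta nu I ^+ 2 = 1.
Proof.
move=> nu01; transitivity (\prod_(i < m) (nu i + (1 - nu i))); last first.
  by rewrite big1 // => i _; rewrite addrC subrK.
rewrite bigA_distr; apply: eq_bigr => I _.
rewrite eta_sqr // [RHS](bigID (mem I)) /=; congr (_ * _).
  by apply: eq_bigr => i ->.
by apply: eq_big => i; rewrite inE // => /negPf ->.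
Qed.

(** * Reduction of the block matrix to the inequality for [phi] *)

Lemma posdefmx_lmi_mx (R : realType) (n m : nat)
    (A : 'M[R]_n) (B : 'M[R]_(n, m)) (W : 'M[R]_n) (U : 'M[R]_m)
    (nu : 'I_m -> R) (K : 'M[R]_(n, m)) (Y : 'M[R]_n) :
  posdefmx W -> possemidefmx U -> (forall i, 0 <= nu i <= 1) -> posdefmx Y ->
  posdefmx (lmi_mx A B W U nu (Y *m K) Y) <->
  posdefmx (invmx Y - phi A B W U nu K (invmx Y)).
Proof.
move=> pW pU nu01 pY; have uY := posdefmx_unit pY.
have [[sV _] VV] := psd_sqrtmxP pU.
rewrite -(posdefmx_congr _ uY) /lmi_mx /=.
set T := mxrow _; set D := mxdiag _.
have pD : posdefmx D.
  by apply: posdefmx_mxdiag => k; apply/posdefmx_block_diag; split=> //;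
     exact: posdefmx1.
(* [T D^-1] is computed pair by pair, each diagonal block of [D] having inverse [diag(Y^-1, I)]. *)
pose T' := \mxrow_(k < 2 ^ m) (submxrow T k *m block_mx (invmx Y) 0 0 1%:M).
have TD : T *m invmx D = T'.
  suff {1}<- : T' *m D = T by rewrite mulmxK ?posdefmx_unit.
  rewrite mul_mxrow_mxdiag -[RHS]submxrowK; apply: eq_mxrow => k.
  rewrite -mulmxA mulmx_block !mulmx0 !mul0mx !addr0 !add0r mulVmx // mulmx1.
  by rewrite -scalar_mx_block mulmx1.
(* Eliminating [D] changes only the upper left block, as the second block row is zero to the
   right. *)
rewrite posdefmx_schur // tr_col_mx mul_col_mx mul_col_row.
rewrite !mul0mx !trmx0 !mulmx0.
rewrite opp_block_mx add_block_mx !subr0.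
(* Writing the lower left [Y] as [Y^T] gives the shape for a second elimination, that of [W^-1],
   which subtracts [Y W Y]. *)
rewrite -[X in block_mx _ _ X _]pY.1.
rewrite posdefmx_schur ?invmxK; last exact: posdefmx_inv.
suff -> : Y - T *m invmx D *m T^T - Y *m W *m Y^T =
  Y^T *m (invmx Y - phi A B W U nu K (invmx Y)) *m Y by [].
rewrite pY.1 mulmxBr mulmxBl mulmxV // mul1mx -addrA -opprD; congr (_ - _).
rewrite TD /T' /T tr_mxrow mul_mxrow_mxcol.
(* Spreading [Y W Y] over the subsets by their weights allows a comparison term by term. *)
have -> : Y *m W *m Y = \sum_(I : {set 'I_m}) eta nu I ^+ 2 *: (Y *m W *m Y).
  by rewrite -scaler_suml sum_eta_sqr // scale1r.
rewrite /phi mulmx_sumr mulmx_suml.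
rewrite (reindex (@subset_of m)) /=; last exact/onW_bij/subset_of_bij.
rewrite [RHS](reindex (@subset_of m)) /=; last exact/onW_bij/subset_of_bij.
rewrite -big_split /=; apply: eq_bigr => k _.
rewrite mxrowK /Fmx /Vmx; set I := subset_of k; set e := eta nu I.
rewrite mul_row_block !mulmx0 addr0 add0r mulmx1 tr_row_mx mul_row_col.
rewrite trmxZ trmxZ.
move: (Nmx R I) (e) => N c; clear -sV VV pY.
rewrite -!scalemxAl -!scalemxAr -!scalemxAl !scalerA -!expr2 -!scalerDr.
congr (_ *: _).
(* With [Z = Y K] the first-row entry is [Y F_I], so [Y^-1] cancels one [Y] in its quadratic
   term. *)
have -> : Y *m A^T + Y *m K *m N *m B^T = Y *m (A^T + K *m N *m B^T).
  by rewrite mulmxDr !mulmxA.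
rewrite -[in RHS]VV !trmx_mul sV pY.1.
move: (A^T + _) => F.
rewrite !mulmxDr !mulmxDl !mulmxA.
by rewrite addrAC addrA.
Qed.

Theorem mainTheorem1 (R : realType) (n m : nat)
  (A : 'M[R]_n) (B : 'M[R]_(n, m)) (W : 'M[R]_n) (U : 'M[R]_m)
  (nu : 'I_m -> R)
  (hW : posdefmx W) (hU : possemidefmx U)
  (hnu : forall i : 'I_m, 0 <= nu i <= 1) :
  (exists (K : 'M[R]_(n, m)) (S : 'M[R]_n),
      posdefmx S /\ posdefmx (S - phi A B W U nu K S))
  <->
  (exists (Z : 'M[R]_(n, m)) (Y : 'M[R]_n),
      posdefmx Y /\ posdefmx (lmi_mx A B W U nu Z Y)).
Proof.
split=> [[K [S [pS pR]]] | [Z [Y [pY pL]]]].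
  have pY := posdefmx_inv pS.
  exists (invmx S *m K), (invmx S); split=> //.
  by apply/(posdefmx_lmi_mx _ _ _ hW hU hnu pY); rewrite invmxK.
(* The substitution is inverted: [K = Y^-1 Z] gives back [Y K = Z]. *)
exists (invmx Y *m Z), (invmx Y); split; first exact: posdefmx_inv.
apply/(posdefmx_lmi_mx _ _ _ hW hU hnu pY).
by rewrite mulKVmx ?posdefmx_unit.
Qed.
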